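(* Consider a power system as described in the context that is weakly synchronized with respect to a partition $\mathcal{I} = \{\mathcal{I}_\ell\}_{\ell=1}^{\hat n}$ of $\mathcal{G}=\{1,\dots,n\}$. Let the initial condition satisfy $\delta(0),\dot\delta(0)\in\mathcal{X}_{\mathrm{cl}}$, and assume $E \in \mathcal{X}_{\mathrm{cl}}$, i.e. $E = P\hat E$ for some $\hat E \in \mathbb{R}^{\hat n}$. Define $$\hat M = P^{\mathsf T}MP,\quad \hat D = P^{\mathsf T}DP,\quad \hat f = P^{\mathsf T}f,\quad \hat L_{\mathrm{D}} = P^{\mathsf T}L_{\mathrm{D}}P,\quad \hat L_{11} = P^{\mathsf T}L_{11}P,\quad \hat L_{12} = P^{\mathsf T}L_{12}.$$ Then the reduced model with unknowns $\hat\delta(t)\in\mathbb{R}^{\hat n}$, $\hat{\mathbf{V}}(t) = [\hat V_\ell(t)(\cos\hat\theta_\ell(t)+\imath\sin\hat\theta_\ell(t))]_{\ell=1}^{\hat n}\in\mathbb{C}^{\hat n}$, $\mathbf{V}_{\overline{\mathcal{G}}}(t)\in\mathbb{C}^{\bar n}$, $$\hat M\ddot{\hat\delta}(t) + \hat D\dot{\hat\delta}(t) = \hat f - \hat L_{\mathrm{D}}\Big[\hat E_\ell\hat V_\ell(t)\sin(\hat\delta_\ell(t)-\hat\theta_\ell(t))\Big]_{\ell=1}^{\hat n},\qquad \begin{bmatrix}\hat L_{\mathrm{D}}(\hat{\mathbf{E}}(t)-\hat{\mathbf{V}}(t))\\0\end{bmatrix} = \begin{bmatrix}\hat L_{11}&\hat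 L_{12}\\ \hat L_{12}^{\mathsf T}&L_{22}\end{bmatrix}\begin{bmatrix}\hat{\mathbf{V}}(t)\\ \mathbf{V}_{\overline{\mathcal{G}}}(t)\end{bmatrix},$$ where $\hat{\mathbf{E}}(t) = [\hat E_\ell(\cos\hat\delta_\ell(t)+\imath\sin\hat\delta_\ell(t))]_{\ell=1}^{\hat n}$, with initial condition $\hat\delta(0) = (P^{\mathsf T}P)^{-1}P^{\mathsf T}\delta(0)$, $\dot{\hat\delta}(0) = (P^{\mathsf T}P)^{-1}P^{\mathsf T}\dot\delta(0)$, exactly reproduces the solution of the original power system: $\delta(t) = P\hat\delta(t)$ and $\mathbf{V}_{\mathcal{G}}(t) = P\hat{\mathbf{V}}(t)$ for all $t\ge0$, with the same $\mathbf{V}_{\overline{\mathcal{G}}}(t)$. Moreover, the reduced model is again a power system of the same form as the original. In particular, $\hat M$, $\hat D$ and $\hat L_{\mathrm{D}}$ are positive definite diagonal matrices, and $\hat L = \begin{bmatrix}\hat L_{11}&\hat L_{12}\\ \hat L_{12}^{\mathsf T}&L_{22}\end{bmatrix}$ is a Laplacian matrix.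
   Context: Power system. Let $\mathcal{G} = \{1,\dots,n\}$ (generators and their generator buses) and $\overline{\mathcal{G}} = \{n+1,\dots,n+\bar n\}$ (non-generator buses). Given are constants: inertias $M_i > 0$, dampings $D_i \ge 0$, input powers $f_i \in \mathbb{R}$, generator voltage amplitudes $E_i$, and reactances $\chi_i > 0$ between the $i$th generator and its bus, for $i \in \mathcal{G}$, and a connected undirected graph on the buses $\mathcal{G} \cup \overline{\mathcal{G}}$ with a reactance $\chi_{ij} = \chi_{ji} > 0$ on each edge. Put $M = \mathrm{diag}(M_i)$, $D = \mathrm{diag}(D_i)$, $f = (f_i)$, $E = (E_i)$, $L_{\mathrm{D}} = \mathrm{diag}(\chi_1^{-1},\dots,\chi_n^{-1})$. Let $L \in \mathbb{R}^{(n+\bar n)\times(n+\bar n)}$ be the weighted graph Laplacian: for $i\neq j$, its $(i,j)$ entry is $-\chi_{ij}^{-1}$ if buses $i,j$ are adjacent and $0$ otherwise, and its diagonal entries make all row sums $0$. Partition $L = \begin{bmatrix} L_{11} & L_{12} \\ L_{12}^{\mathsf T} & L_{22}\end{bmatrix}$ according to $\mathcal{G}, \overline{\mathcal{G}}$. The unknowns are the generator phases $\delta(t) \in \mathbb{R}^n$ and the complex bus voltages $\mathbf{V}_{\mathcal{G}}(t) = [V_i(t)(\cos\theta_i(t) + \imath \sin\theta_i(t))]_{i \in \mathcal{G}} \in \mathbb{C}^n$ and $\mathbf{V}_{\overline{\mathcal{G}}}(t) \in \mathbb{C}^{\bar n}$, where $V_i(t)$, $\theta_i(t)$ are voltage amplitude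 and phase and $\imath$ is the imaginary unit. With $\mathbf{E}_{\mathcal{G}}(t) = [E_i(\cos\delta_i(t) + \imath\sin\delta_i(t))]_{i\in\mathcal{G}}$, the power system is the differential-algebraic system, $t \ge 0$, $$M\ddot\delta(t) + D\dot\delta(t) = f - \Big[\tfrac{E_iV_i(t)}{\chi_i}\sin(\delta_i(t)-\theta_i(t))\Big]_{i\in\mathcal{G}}, \qquad \begin{bmatrix} L_{\mathrm{D}}(\mathbf{E}_{\mathcal{G}}(t) - \mathbf{V}_{\mathcal{G}}(t)) \\ 0\end{bmatrix} = \begin{bmatrix} L_{11} & L_{12} \\ L_{12}^{\mathsf T} & L_{22}\end{bmatrix}\begin{bmatrix}\mathbf{V}_{\mathcal{G}}(t)\\ \mathbf{V}_{\overline{\mathcal{G}}}(t)\end{bmatrix}.$$ Notation. For a partition $\mathcal{I} = \{\mathcal{I}_\ell\}_{\ell=1}^{\hat n}$ of $\mathcal{G}$ into nonempty disjoint clusters, the aggregation matrix $P\in\mathbb{R}^{n\times\hat n}$ has entries $P_{i\ell} = 1$ if $i\in\mathcal{I}_\ell$ and $0$ otherwise, and $\mathcal{X}_{\mathrm{cl}} = \{x\in\mathbb{R}^n : x_i = x_j \text{ whenever } i,j \text{ lie in the same cluster}\} = \mathrm{Im}\,P$. For a complex vector, ''$x\in\mathcal{X}_{\mathrm{cl}}$'' likewise means that $x$ is constant on each cluster. Definition. The power system is weakly synchronized with respect to $\mathcal{I}$ if, for every initial condition $\delta(0),\dot\delta(0)\in\mathcal{X}_{\mathrm{cl}}$, the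 solution satisfies $\delta(t)\in\mathcal{X}_{\mathrm{cl}}$ and $\mathbf{V}_{\mathcal{G}}(t)\in\mathcal{X}_{\mathrm{cl}}$ for all $t\ge0$.
   Formalization: Since D_i ≥ 0 allows all dampings in a cluster to vanish, D̂ is shown to be diagonal and positive semidefinite, and positive definite when every cluster contains a generator with D_i > 0 (a condition that is also necessary). *)

(* Defs.v *)
From HB Require Import structures.
From mathcomp Require Import all_boot all_order all_algebra.
From mathcomp Require Import all_classical all_reals all_analysis.
From mathcomp Require Import complex.

Set Implicit Arguments.
Unset Strict Implicit.
Unset Printing Implicit Defensive.

Import Order.TTheory GRing.Theory Num.Theory.
Import numFieldNormedType.Exports.

Local Open Scope ring_scope.
Local Open Scope complex_scope.

(* A connected undirected graph on N buses with positive edge reactances.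
   The value of [reactance] off the edges is irrelevant. *)
Record network (R : realType) (N : nat) := Network {
  adj : rel 'I_N;
  reactance : 'I_N -> 'I_N -> R;
  adj_sym : symmetric adj;
  adj_irrefl : irreflexive adj;
  adj_connected : forall i j, connect adj i j;
  reactance_sym : forall i j, adj i j -> reactance i j = reactance j i;
  reactance_gt0 : forall i j, adj i j -> 0 < reactance i j }.

Definition laplacian (R : realType) (N : nat) (G : network R N) : 'M[R]_N :=
  \matrix_(i, j) if i == j then \sum_(k | adj G i k) (reactance G i k)^-1
                 else if adj G i j then - (reactance G i j)^-1 else 0.

Definition is_laplacian (R : realType) (N : nat) (A : 'M[R]_N) : Prop :=
  exists G : network R N, A = laplacian G.

(* Buses are indexed by 'I_(n + m): the generator buses come first, followed by
   the m non-generator buses. *)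
Record power_system (R : realType) (n m : nat) := PowerSystem {
  inertia : 'cV[R]_n;
  damping : 'cV[R]_n;
  input_power : 'cV[R]_n;
  gen_voltage : 'cV[R]_n;
  gen_reactance : 'cV[R]_n;
  grid : network R (n + m);
  gen_nonempty : (0 < n)%N;
  inertia_gt0 : forall i, 0 < inertia i 0;
  damping_ge0 : forall i, 0 <= damping i 0;
  gen_reactance_gt0 : forall i, 0 < gen_reactance i 0 }.

Section PowerSystemMatrices.
Variables (R : realType) (n m : nat) (S : power_system R n m).

Definition inertia_mx : 'M[R]_n := diag_mx (inertia S)^T.
Definition damping_mx : 'M[R]_n := diag_mx (damping S)^T.
Definition LD_mx : 'M[R]_n := diag_mx (\row_i (gen_reactance S i 0)^-1).
Definition L11_mx : 'M[R]_n := ulsubmx (laplacian (grid S)).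
Definition L12_mx : 'M[R]_(n, m) := ursubmx (laplacian (grid S)).
Definition L22_mx : 'M[R]_m := drsubmx (laplacian (grid S)).

End PowerSystemMatrices.

Section Solutions.
Variable R : realType.

Definition toC (p q : nat) (A : 'M[R]_(p, q)) : 'M[R[i]]_(p, q) :=
  map_mx (real_complex R) A.

Definition polar (n : nat) (r phi : 'cV[R]_n) : 'cV[R[i]]_n :=
  \col_i ((r i 0)%:C * (cos (phi i 0) +i* sin (phi i 0))).

(* v is the entrywise time derivative of x on [0, +oo[: two-sided at t > 0 and
   one-sided at t = 0; the values at negative times play no role. *)
Definition has_velocity (n : nat) (x v : R -> 'cV[R]_n) : Prop :=
  forall t : R, 0 <= t -> forall i : 'I_n,
    ((fun s => (x s i 0 - x t i 0) / (s - t))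
       @ within [set s : R | 0 <= s] t^' --> v t i 0)%classic.

(* (delta, ddelta, VG, VN) is a solution on [0, +oo[ of the power system:
   ddelta is the derivative of delta, VG and VN are the complex voltages of the
   generator and non-generator buses. *)
Definition solution (n m : nat) (S : power_system R n m)
    (delta ddelta : R -> 'cV[R]_n)
    (VG : R -> 'cV[R[i]]_n) (VN : R -> 'cV[R[i]]_m) : Prop :=
  exists (dddelta V theta : R -> 'cV[R]_n),
    [/\ has_velocity delta ddelta,
        has_velocity ddelta dddelta &
        forall t : R, 0 <= t ->
        [/\ VG t = polar (V t) (theta t),
            inertia_mx S *m dddelta t + damping_mx S *m ddelta t
            = input_power S
              - \col_i (gen_voltage S i 0 * V t i 0 / gen_reactance S i 0
                        * sin (delta t i 0 - theta t i 0)) &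
            col_mx (toC (LD_mx S)
                      *m (polar (gen_voltage S) (delta t) - VG t)) 0
            = toC (block_mx (L11_mx S) (L12_mx S) (L12_mx S)^T (L22_mx S))
              *m col_mx (VG t) (VN t)]].

(* The reduced model, for arbitrary matrices in place of the hatted ones. *)
Definition reduced_solution (k m : nat) (Mh Dh LDh L11h : 'M[R]_k)
    (L12h : 'M[R]_(k, m)) (L22 : 'M[R]_m) (fh Eh : 'cV[R]_k)
    (deltah ddeltah : R -> 'cV[R]_k)
    (Vch : R -> 'cV[R[i]]_k) (VN : R -> 'cV[R[i]]_m) : Prop :=
  exists (dddeltah Vh thetah : R -> 'cV[R]_k),
    [/\ has_velocity deltah ddeltah,
        has_velocity ddeltah dddeltah &
        forall t : R, 0 <= t ->
        [/\ Vch t = polar (Vh t) (thetah t),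
            Mh *m dddeltah t + Dh *m ddeltah t
            = fh - LDh *m \col_l (Eh l 0 * Vh t l 0
                                  * sin (deltah t l 0 - thetah t l 0)) &
            col_mx (toC LDh *m (polar Eh (deltah t) - Vch t)) 0
            = toC (block_mx L11h L12h L12h^T L22)
              *m col_mx (Vch t) (VN t)]].

End Solutions.

(* Injectivity makes the indexed clusters pairwise disjoint; [partition] makes
   them nonempty with union the whole of 'I_n. *)
Definition clustering (n k : nat) (I : 'I_k -> {set 'I_n}) : Prop :=
  injective I /\ finset.partition [set I l | l in 'I_k]%SET [set: 'I_n]%SET.

Definition aggregation_mx (R : realType) (n k : nat)
    (I : 'I_k -> {set 'I_n}) : 'M[R]_(n, k) :=
  \matrix_(i, l) (i \in I l)%:R.

Definition in_Xcl (T : Type) (n k : nat) (I : 'I_k -> {set 'I_n})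
    (x : 'cV[T]_n) : Prop :=
  forall l i j, i \in I l -> j \in I l -> x i ord0 = x j ord0.

Definition weakly_synchronized (R : realType) (n m k : nat)
    (S : power_system R n m) (I : 'I_k -> {set 'I_n}) : Prop :=
  forall delta ddelta VG VN,
    solution S delta ddelta VG VN ->
    in_Xcl I (delta 0) -> in_Xcl I (ddelta 0) ->
    forall t : R, 0 <= t -> in_Xcl I (delta t) /\ in_Xcl I (VG t).

Definition posdef (R : realType) (n : nat) (A : 'M[R]_n) : Prop :=
  A^T = A /\ forall x : 'cV[R]_n, x != 0 -> 0 < (x^T *m A *m x) 0 0.

Definition possemidef (R : realType) (n : nat) (A : 'M[R]_n) : Prop :=
  A^T = A /\ forall x : 'cV[R]_n, 0 <= (x^T *m A *m x) 0 0.

(* Main.v *)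
Require Import Defs.
From mathcomp Require Import all_boot all_order all_algebra.
From mathcomp Require Import all_classical all_reals all_analysis.
From mathcomp Require Import complex.
From mathcomp Require Import ring lra.
Import Order.TTheory GRing.Theory Num.Theory.
Import numFieldNormedType.Exports.
Local Open Scope ring_scope.

Set Implicit Arguments.
Unset Strict Implicit.

(** Merging the buses of each cluster gives a weighted graph whose Laplacian is
    Q^T L Q, with Q the 0/1 matrix of the merging map; it is connected because
    the map is surjective, so the reduced model is a power system. A synchronous
    solution read off at one representative per cluster solves the reduced model:
    V sin(delta - theta) is determined by delta and by the complex voltage alone,
    hence is constant on clusters even though V and theta need not be.
    Conversely, solutions of any power system are unique: grounding a connected
    Laplacian at one bus makes it invertible, so the voltages are linear functions
    of the internal voltages, and the swing equation becomes
    M_i delta_i'' + D_i delta_i' = f_i - (E_i / chi_i) sum_j B_ij E_j sin(delta_i - delta_j),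
    a second-order system with Lipschitz right-hand side. *)

(** * Uniqueness for second-order differential inequalities *)

(* Turns one-sided differentiability at 0 into differentiability, without using
   values of [f] at negative times. *)
Definition odd_extension (R : realType) (f : R -> R) (s : R) : R :=
  if 0 <= s then f s else 2 * f 0 - f (- s).

(** For [t > 0] all nearby points are positive and nothing changes. At [t = 0] the difference
    quotient of the extension at [h < 0] equals the quotient of [f] at [- h], so the one-sided limit
    serves both sides. *)
Lemma is_derive_odd_extension (R : realType) (f : R -> R) (v t : R) :
  0 <= t ->
  ((fun s => (f s - f t) / (s - t)) @ within [set s : R | 0 <= s] t^' --> v)%classic ->
  is_derive t 1 (odd_extension f) v.
Proof.
move=> t_ge0 fv.
suff cv : ((fun h => h^-1 *: ((odd_extension f \o shift t) (h *: 1) -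
    odd_extension f t)) @ 0^' --> v)%classic.
  by split; [apply/cvg_ex; exists v | exact/cvg_lim].
apply/cvgrPdist_lt => e e_gt0.
move/cvgrPdist_lt: fv => /(_ e e_gt0) /nbhs_ballP [d /= d_gt0 fd].
(* The bound by [t] keeps [h + t] positive when [t > 0], so the reflected branch can only occur at
   [t = 0]. *)
pose r := if t == 0 then d else Num.min d t.
have r_gt0 : 0 < r.
  by rewrite /r; case: eqVneq => // tN0; rewrite lt_min d_gt0 lt0r tN0.
have r_le : r <= d by rewrite /r; case: eqP => // _; rewrite ge_min lexx.
apply/nbhs_ballP; exists r => //= h hr hN0.
have {}hr : `|h| < r by move: hr; rewrite /ball /= sub0r normrN.
rewrite /odd_extension t_ge0 /= scaler1.
have fd' k : k != 0 -> `|k| < d -> 0 <= k + t -> `|v - (f (k + t) - f t) / k| < e.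
  move=> kN0 kd kt; have := fd (k + t); rewrite addrK; apply => //.
    by rewrite /ball /= distrC addrK.
  by rewrite -subr_eq0 addrK.
rewrite /GRing.scale /= mulrC; case: ifPn => [ht|].
  by apply: fd' => //; exact: lt_le_trans r_le.
rewrite -ltNge => ht.
have t0 : t = 0.
  apply/eqP; case: eqVneq hr => // tN0; rewrite /r (negbTE tN0) lt_min.
  by move=> /andP[_]; rewrite ltr_norml => /andP[]; lra.
have := fd' (- h); rewrite t0 !addr0 oppr_eq0 normrN.
have -> : (f (- h) - f 0) / - h = (2 * f 0 - f (- h) - f 0) / h.
  by rewrite invrN mulrN -mulNr; congr (_ / _); ring.
apply => //; first exact: lt_le_trans r_le.
by move: ht; rewrite t0; lra.
Qed.

(** Mean value theorem, with the derivative [cos] bounded by 1 in absolute value. *)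
Lemma ler_dist_sin (R : realType) (a b : R) : `|sin a - sin b| <= `|a - b|.
Proof.
wlog ab : a b / b <= a.
  by move=> h; case: (leP b a) => [|/ltW] /h //; rewrite distrC (distrC b).
have [|c _ ->] := MVT_segment ab (fun x _ => is_derive_sin x).
  by apply: continuous_subspaceT => x; exact: continuous_sin.
by rewrite normrM ler_piMl // ler_norml cos_geN1 cos_le1.
Qed.

(** The product [h] of [w] with [expR (- C * s)] has nonpositive derivative and starts at 0, so the
    mean value theorem gives [h t <= 0], while [w] is nonnegative. *)
Lemma gronwall_eq0 (R : realType) (w w' : R -> R) (C : R) :
  (forall t : R, 0 <= t -> is_derive t 1 w (w' t)) ->
  (forall t : R, 0 <= t -> w' t <= C * w t) ->
  (forall t, 0 <= w t) -> w 0 = 0 ->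
  forall t : R, 0 <= t -> w t = 0.
Proof.
move=> dw w'_le w_ge0 w0 t t_ge0.
pose h s := w s * expR (- C * s).
have dh (s : R) : 0 <= s -> is_derive s 1 h ((w' s - C * w s) * expR (- C * s)).
  move=> s_ge0; have dws := dw _ s_ge0.
  have dexp : is_derive s 1 (fun s => expR (- C * s)) (- C * expR (- C * s)).
    have -> : (fun s => expR (- C * s)) = expR \o (fun s : R => - C * s) by [].
    have dlin : is_derive s 1 (fun s : R => - C * s) (- C).
      apply: is_derive_eq (is_deriveZ (- C) (is_derive_id s (1 : R))) _.
      by rewrite /GRing.scale /= mulr1.
    apply: is_derive_eq (is_derive1_comp (is_derive_expR (- C * s)) dlin) _.
    by rewrite mulrC.
  apply: is_derive_eq (is_deriveM dws dexp) _.
  by rewrite /GRing.scale /=; ring.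
have dh_itv (s : R) : s \in `]0, t[ ->
    is_derive s 1 h ((w' s - C * w s) * expR (- C * s)).
  by rewrite in_itv /= => /andP[/ltW s_ge0 _]; exact: dh.
have [|c /itvP cP] := MVT_segment t_ge0 dh_itv.
  apply: derivable_within_continuous => s; rewrite in_itv /= => /andP[s0 _].
  by have [] := dh s s0.
have c_ge0 : 0 <= c by rewrite cP.
rewrite {2}/h w0 mul0r !subr0 => ht.
have : h t <= 0.
  rewrite ht mulr_le0_ge0 // mulr_le0_ge0 ?expR_ge0 //.
  by rewrite subr_le0 w'_le.
rewrite /h pmulr_lle0 ?expR_gt0 // => wt; apply/le_anti.
by rewrite wt w_ge0.
Qed.

Lemma sum_pairwise_add (R : comRingType) (n : nat) (f : 'I_n -> R) :
  \sum_(i < n) \sum_(j < n) (f i + f j) = 2 * n%:R * \sum_(i < n) f i.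
Proof.
under eq_bigr => i _ do rewrite big_split /= sumr_const card_ord.
rewrite big_split /= sumr_const card_ord -[in LHS]mulr_natl.
under eq_bigr => i _ do rewrite -mulr_natl.
by rewrite -mulr_sumr; ring.
Qed.

(** The Gronwall argument is applied to the energy [w], the sum of all squared positions and
    velocities. *)
Lemma second_order_gronwall_eq0 (R : realType) (n : nat)
    (x v a : 'I_n -> R -> R) (C : R) :
  (forall t : R, 0 <= t -> forall i, is_derive t 1 (x i) (v i t)) ->
  (forall t : R, 0 <= t -> forall i, is_derive t 1 (v i) (a i t)) ->
  (forall t : R, 0 <= t -> forall i,
    `|a i t| <= C * \sum_j (`|x j t| + `|v j t|)) ->
  0 <= C -> (forall i, x i 0 = 0) -> (forall i, v i 0 = 0) ->
  forall t : R, 0 <= t -> forall i, x i t = 0 /\ v i t = 0.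
Proof.
move=> dx dv a_le C_ge0 x0 v0 t t_ge0 i.
pose w := \sum_(j < n) (x j ^+ 2 + v j ^+ 2).
have wE s : w s = \sum_(j < n) (x j s ^+ 2 + v j s ^+ 2).
  by rewrite /w fct_sumE; apply: eq_bigr => j _; rewrite /GRing.add /=.
pose w' s := \sum_(j < n) (2 * x j s * v j s + 2 * v j s * a j s).
have w_ge0 s : 0 <= w s.
  by rewrite wE sumr_ge0 // => j _; rewrite addr_ge0 ?sqr_ge0.
have dsq (s : R) : 0 <= s -> forall j, is_derive s 1 (x j ^+ 2 + v j ^+ 2)
    (2 * x j s * v j s + 2 * v j s * a j s).
  move=> s_ge0 j; have dxs := dx _ s_ge0 j; have dvs := dv _ s_ge0 j.
  apply: is_derive_eq (is_deriveD (is_deriveX 2 dxs) (is_deriveX 2 dvs)) _.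
  by rewrite /GRing.scale /= !expr1.
have dw (s : R) : 0 <= s -> is_derive s 1 w (w' s).
  by move=> s_ge0; exact: (is_derive_sum (dsq s s_ge0)).
(* The constant is the product of [2 * (1 + C)], which bounds [w'] by the square of the l1 norm [T],
   and of [2 * n], which bounds that square by the energy. *)
have w'_le (s : R) : 0 <= s -> w' s <= 4 * (1 + C) * n%:R * w s.
  move=> s_ge0; pose p j := `|x j s| + `|v j s|; pose T := \sum_j p j.
  have p_ge0 j : 0 <= p j by rewrite addr_ge0.
  have T_ge0 : 0 <= T by exact: sumr_ge0.
  (* Each summand of [w'] is [2 * v_j * (x_j + a_j)], where [|x_j + a_j| <= (1 + C) * T] and
     [|v_j| <= p_j]; the [p_j] add up to [T]. *)
  have w'T : w' s <= 2 * (1 + C) * T ^+ 2.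
    have -> : 2 * (1 + C) * T ^+ 2 = \sum_j 2 * (1 + C) * T * p j.
      by rewrite -mulr_sumr expr2 !mulrA.
    apply: ler_sum => j _; rewrite -!mulrA -mulrDr ler_pM2l // [x j s * _]mulrC.
    rewrite -mulrDr (le_trans (ler_norm _)) // normrM mulrC mulrA.
    apply: ler_pM => //; last by rewrite lerDr.
    rewrite (le_trans (ler_normD _ _)) // mulrDl mul1r lerD ?a_le //.
    apply: (@le_trans _ _ (p j)); first by rewrite lerDl.
    by rewrite /T (bigD1 j) //= lerDl sumr_ge0.
  have Tw : T ^+ 2 <= 2 * n%:R * w s.
    have pw j : p j ^+ 2 <= 2 * (x j s ^+ 2 + v j s ^+ 2).
      rewrite /p -(real_normK (num_real (x j s))) -(real_normK (num_real (v j s))).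
      by have := sqr_ge0 (`|x j s| - `|v j s|); nra.
    have -> : T ^+ 2 = \sum_i \sum_j p i * p j.
      by rewrite expr2 mulr_suml; apply: eq_bigr => j _; rewrite mulr_sumr.
    have -> : 2 * n%:R * w s = \sum_(i < n) \sum_(j < n)
        ((x i s ^+ 2 + v i s ^+ 2) + (x j s ^+ 2 + v j s ^+ 2)).
      by rewrite (sum_pairwise_add (fun i => x i s ^+ 2 + v i s ^+ 2)) wE.
    apply: ler_sum => j _; apply: ler_sum => l _.
    by have := sqr_ge0 (p j - p l); have := pw j; have := pw l; nra.
  apply: (le_trans w'T).
  have -> : 4 * (1 + C) * n%:R * w s = 2 * (1 + C) * (2 * n%:R * w s) by ring.
  by rewrite ler_wpM2l // mulr_ge0 // addr_ge0.
have w0 : w 0 = 0 by rewrite wE big1 // => j _; rewrite x0 v0 expr0n addr0.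
have := gronwall_eq0 dw w'_le w_ge0 w0 t_ge0; rewrite wE => /eqP; rewrite psumr_eq0; last first.
  by move=> j _; rewrite addr_ge0 ?sqr_ge0.
move=> /allP /(_ i (mem_index_enum _)) /=.
rewrite paddr_eq0 ?sqr_ge0 // !sqrf_eq0 => /andP[/eqP-> /eqP->].
by [].
Qed.

(** * Weighted Laplacians and their quotients *)

Lemma sum_delta (T : pzSemiRingType) (N : nat) (f : 'I_N -> T) (i : 'I_N) :
  \sum_j (i == j)%:R * f j = f i.
Proof.
rewrite (bigD1 i) //= eqxx mul1r big1 ?addr0 // => j ji.
by rewrite eq_sym (negbTE ji) mul0r.
Qed.

(** Extending the inverse reactance by zero off the edges lets sums range over all pairs of
    buses. *)
Definition conductance (R : realType) (N : nat) (G : network R N) (i j : 'I_N) : R :=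
  if adj G i j then (reactance G i j)^-1 else 0.

Section LaplacianTheory.
Variables (R : realType) (N : nat) (G : network R N).

Lemma conductance_sym i j : conductance G i j = conductance G j i.
Proof.
rewrite /conductance adj_sym; case: ifP => // adj_ji.
by rewrite reactance_sym // adj_sym.
Qed.

Lemma conductance_ge0 i j : 0 <= conductance G i j.
Proof.
by rewrite /conductance; case: ifP => // /reactance_gt0 x_gt0; rewrite invr_ge0 ltW.
Qed.

Lemma conductance_gt0 i j : (0 < conductance G i j) = adj G i j.
Proof.
rewrite /conductance; case: ifP => [/reactance_gt0|_]; last by rewrite ltxx.
by rewrite invr_gt0.
Qed.

Lemma conductance_diag i : conductance G i i = 0.
Proof. by rewrite /conductance adj_irrefl. Qed.

Lemma laplacianE i j :
  laplacian G i j = (i == j)%:R * (\sum_l conductance G i l) - conductance G i j.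
Proof.
rewrite mxE; case: eqVneq => [<-|_].
  by rewrite mul1r conductance_diag subr0 [LHS]big_mkcond.
by rewrite mul0r sub0r /conductance; case: ifP => // _; rewrite oppr0.
Qed.

Lemma laplacian_sym : (laplacian G)^T = laplacian G.
Proof.
apply/matrixP => i j; rewrite mxE !laplacianE conductance_sym eq_sym.
by case: eqVneq => [->|_] //; rewrite !mul0r.
Qed.

Lemma laplacian_row_sum i : \sum_j laplacian G i j = 0.
Proof.
under eq_bigr do rewrite laplacianE.
by rewrite sumrB (sum_delta (fun=> _)) subrr.
Qed.

(** The form is a sum of terms [w_ij * x_i * (x_i - x_j)]. Exchanging [i] and [j] gives a second
    such expression, and the two add up to the square. *)
Lemma laplacian_dirichlet (x : 'I_N -> R) :
  2 * (\sum_i \sum_j x i * laplacian G i j * x j) =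
  \sum_i \sum_j conductance G i j * (x i - x j) ^+ 2.
Proof.
have halfE : \sum_i \sum_j x i * laplacian G i j * x j =
    \sum_i \sum_j conductance G i j * (x i * (x i - x j)).
  apply: eq_bigr => i _.
  under eq_bigr do rewrite laplacianE mulrBr mulrBl mulrCA -mulrA.
  rewrite sumrB sum_delta mulr_sumr mulr_suml -sumrB.
  by apply: eq_bigr => j _; ring.
have halfE' : \sum_i \sum_j x i * laplacian G i j * x j =
    \sum_i \sum_j conductance G i j * (x j * (x j - x i)).
  rewrite halfE exchange_big; apply: eq_bigr => i _; apply: eq_bigr => j _.
  by rewrite conductance_sym.
rewrite mulr_natl mulr2n {1}halfE halfE' -big_split /=.
apply: eq_bigr => i _; rewrite -big_split /=; apply: eq_bigr => j _; ring.
Qed.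

(* The quadratic form of the Laplacian vanishes only on constants, as the graph
   is connected, and the grounded bus [i0] excludes the nonzero constants. *)
Lemma grounded_laplacian_unit (d : 'rV[R]_N) (i0 : 'I_N) :
  (forall i, 0 <= d 0 i) -> 0 < d 0 i0 -> laplacian G + diag_mx d \in unitmx.
Proof.
move=> d_ge0 d_gt0; rewrite -row_free_unit -kermx_eq0; apply/rowV0P => v.
move/sub_kermxP => vA; pose x i := v 0 i.
have sum0 : \sum_i \sum_j x i * laplacian G i j * x j + \sum_i d 0 i * x i ^+ 2 = 0.
  have : (v *m (laplacian G + diag_mx d) *m v^T) 0 0 = 0 by rewrite vA mul0mx mxE.
  rewrite mulmxDr mulmxDl mxE => eq0; rewrite -[RHS]eq0; congr (_ + _).
    rewrite exchange_big mxE; apply: eq_bigr => j _ /=.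
    by rewrite !mxE mulr_suml.
  by rewrite mul_mx_diag mxE; apply: eq_bigr => j _; rewrite !mxE /x; ring.
have wx_ge0 i j : 0 <= conductance G i j * (x i - x j) ^+ 2.
  by rewrite mulr_ge0 ?conductance_ge0 ?sqr_ge0.
have dx_ge0 i : 0 <= d 0 i * x i ^+ 2 by rewrite mulr_ge0 ?sqr_ge0.
have Q_ge0 : 0 <= \sum_i \sum_j x i * laplacian G i j * x j.
  rewrite -(pmulr_rge0 _ (ltr0Sn R 1)) laplacian_dirichlet.
  by apply: sumr_ge0 => i _; apply: sumr_ge0 => j _.
have D_ge0 : 0 <= \sum_i d 0 i * x i ^+ 2 by exact: sumr_ge0.
move/eqP: sum0; rewrite paddr_eq0 // => /andP[/eqP Q0 /eqP D0].
have x_i0 : x i0 = 0.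
  have /eqP := D0; rewrite psumr_eq0 // => /allP /(_ i0 (mem_index_enum _)) /=.
  by rewrite mulf_eq0 sqrf_eq0 gt_eqF //= => /eqP.
have x_adj i j : adj G i j -> x i = x j.
  move=> ij; have := laplacian_dirichlet x; rewrite Q0 mulr0 => /esym/eqP.
  rewrite psumr_eq0 => [|l _]; last exact: sumr_ge0.
  move=> /allP /(_ i (mem_index_enum _)) /=; rewrite psumr_eq0 // => /allP.
  move=> /(_ j (mem_index_enum _)); rewrite /= mulf_eq0 sqrf_eq0 subr_eq0 gt_eqF.
    by move/eqP.
  by rewrite conductance_gt0.
have x_connect i : x i = x i0.
  case/connectP: (adj_connected G i i0) => p; elim: p i => [|j p IHp] i /=.
    by move=> _ ->.
  by case/andP=> /x_adj -> jp /(IHp _ jp).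
by apply/rowP => i; rewrite mxE -/(x i) x_connect.
Qed.

End LaplacianTheory.

(** Serves to compare Laplacians without computing their diagonals. *)
Lemma eq_of_off_diag_row_sum (R : zmodType) (N : nat) (A B : 'M[R]_N) :
  (forall i j, i != j -> A i j = B i j) ->
  (forall i, \sum_j A i j = \sum_j B i j) -> A = B.
Proof.
move=> off rows; apply/matrixP => i j; case: (eqVneq i j) => [<-|/off //].
have := rows i; rewrite (bigD1 i) //= [RHS](bigD1 i) //=.
rewrite (eq_bigr (B i)) => [/addIr //|l li]; by rewrite off // eq_sym.
Qed.

(** Multiplying on the left by this matrix composes a vector with [c]; its transpose sums over the
    fibers of [c]. The entry type is left general because the matrix acts on both real and complex
    vectors. *)
Definition fiber_mx (T : pzSemiRingType) (N K : nat) (c : 'I_N -> 'I_K) : 'M[T]_(N, K) :=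
  \matrix_(i, l) (c i == l)%:R.

Section FiberMatrix.
Variables (T : pzSemiRingType) (N K : nat) (c : 'I_N -> 'I_K).

Lemma fiber_mxE p (x : 'M[T]_(K, p)) i j : (fiber_mx T c *m x) i j = x (c i) j.
Proof.
by rewrite mxE -[RHS](sum_delta (x^~ j)); apply: eq_bigr => l _; rewrite mxE.
Qed.

Lemma tr_fiber_mxE p (x : 'M[T]_(N, p)) l j :
  ((fiber_mx T c)^T *m x) l j = \sum_(i | c i == l) x i j.
Proof.
rewrite mxE [RHS]big_mkcond; apply: eq_bigr => i _; rewrite !mxE.
by case: (c i == l); rewrite ?mul1r ?mul0r.
Qed.

Lemma mul_fiber_mxE p (x : 'M[T]_(p, N)) i l :
  (x *m fiber_mx T c) i l = \sum_(j | c j == l) x i j.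
Proof.
rewrite mxE [RHS]big_mkcond; apply: eq_bigr => j _; rewrite !mxE.
by case: (c j == l); rewrite ?mulr1 ?mulr0.
Qed.

(** An index lies in exactly one fiber, so no diagonal entry contributes to two different
    clusters. *)
Lemma fiber_diag_mx (d : 'rV[T]_N) :
  (fiber_mx T c)^T *m diag_mx d *m fiber_mx T c =
  diag_mx (\row_l \sum_(i | c i == l) d 0 i).
Proof.
apply/matrixP => a b; rewrite -mulmxA tr_fiber_mxE !mxE.
under eq_bigr => i _ do rewrite mul_fiber_mxE.
rewrite -sumrMnl; apply: eq_bigr => i /eqP <-.
under eq_bigr => j _ do rewrite mxE.
case: (eqVneq (c i) b) => [ci|cb].
  rewrite (bigD1 i) ?ci //= eqxx big1 ?addr0 // => j /andP[_ ji].
  by rewrite eq_sym (negbTE ji).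
rewrite big1 // => j /eqP cj; case: eqVneq => // ij.
by rewrite ij cj eqxx in cb.
Qed.

End FiberMatrix.

(** * Merging the buses of a network along a surjection *)

Section QuotientNetwork.
Variables (R : realType) (N K : nat) (G : network R N) (c : 'I_N -> 'I_K).

(** Lines joining the same two fibers become parallel, so their inverse reactances add. *)
Let cond a b := \sum_(i | c i == a) \sum_(j | c j == b) conductance G i j.

Let qadj : rel 'I_K :=
  fun a b => (a != b) && [exists i, exists j, [&& c i == a, c j == b & adj G i j]].

Let cond_sym a b : cond a b = cond b a.
Proof.
rewrite /cond exchange_big; apply: eq_bigr => i _; apply: eq_bigr => j _.
exact: conductance_sym.
Qed.

Let cond_gt0 a b : qadj a b -> 0 < cond a b.
Proof.
case/andP=> _ /existsP[i /existsP[j /and3P[ca cb ij]]].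
rewrite /cond (bigD1 i) //= (bigD1 j) //= -addrA ltr_pwDl ?conductance_gt0 //.
rewrite addr_ge0 // sumr_ge0 // => *; rewrite ?sumr_ge0 // => *.
all: exact: conductance_ge0.
Qed.

Let cond_eq0 a b : a != b -> ~~ qadj a b -> cond a b = 0.
Proof.
rewrite /qadj => -> /= /existsPn nadj; rewrite /cond big1 // => i ca.
rewrite big1 // => j cb; have /existsPn/(_ j) := nadj i.
by rewrite ca cb /= /conductance => /negbTE->.
Qed.

Let qadj_sym : symmetric qadj.
Proof.
move=> a b; rewrite /qadj eq_sym; congr (_ && _).
by apply/existsP/existsP => -[i /existsP[j /and3P[ca cb ij]]]; exists j;
  apply/existsP; exists i; rewrite ca cb adj_sym.
Qed.

Let qadj_irrefl : irreflexive qadj.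
Proof. by move=> a; rewrite /qadj eqxx. Qed.

(** A path between preimages projects to a path: each edge either maps to an edge or collapses to a
    point. *)
Let qadj_connected : (forall a, exists i, c i = a) -> forall a b, connect qadj a b.
Proof.
move=> c_surj a b; have [[i <-] [j <-]] := (c_surj a, c_surj b).
case/connectP: (adj_connected G i j) => p; elim: p i => [|l p IHp] i /=.
  by move=> _ ->.
case/andP=> il lp /(IHp _ lp); apply: connect_trans.
case: (eqVneq (c i) (c l)) => [-> //|ci_cl]; apply: connect1.
rewrite /qadj ci_cl; apply/existsP; exists i; apply/existsP; exists l.
by rewrite !eqxx.
Qed.

Let qreactance_sym a b : qadj a b -> (cond a b)^-1 = (cond b a)^-1.
Proof. by rewrite cond_sym. Qed.

Let qreactance_gt0 a b : qadj a b -> 0 < (cond a b)^-1.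
Proof. by rewrite invr_gt0; exact: cond_gt0. Qed.

Definition quotient_network (c_surj : forall a, exists i, c i = a) : network R K :=
  Network qadj_sym qadj_irrefl (qadj_connected c_surj) qreactance_sym qreactance_gt0.

(** Off the diagonal both sides are minus the total conductance between two distinct fibers. Both
    have zero row sums: a row sum on the right is a sum of row sums of [laplacian G] over a
    fiber. *)
Lemma laplacian_quotient (c_surj : forall a, exists i, c i = a) :
  laplacian (quotient_network c_surj) =
  (fiber_mx R c)^T *m laplacian G *m fiber_mx R c.
Proof.
apply: eq_of_off_diag_row_sum => [a b ab|a]; last first.
  rewrite laplacian_row_sum; under eq_bigr do rewrite -mulmxA tr_fiber_mxE.
  rewrite exchange_big big1 //= => i _; rewrite -[RHS](laplacian_row_sum G i).
  under eq_bigr do rewrite mul_fiber_mxE.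
  by rewrite [RHS](partition_big c xpredT).
rewrite -mulmxA tr_fiber_mxE laplacianE (negbTE ab) mul0r sub0r.
have -> : conductance (quotient_network c_surj) a b = cond a b.
  rewrite /conductance /=; case: ifPn => [_|/cond_eq0 -> //]; exact: invrK.
rewrite /cond -sumrN; apply: eq_bigr => i /eqP ca; rewrite mul_fiber_mxE -sumrN.
apply: eq_bigr => j /eqP cb; rewrite laplacianE.
case: (eqVneq i j) => [ij|_]; last by rewrite mul0r sub0r.
by rewrite -ca -cb ij eqxx in ab.
Qed.

End QuotientNetwork.

(** * Solutions of a power system *)

Section PolarCoordinates.
Variable R : realType.
Implicit Types (n m : nat).

Lemma polar_Re n (r phi : 'cV[R]_n) i :
  complex.Re (polar r phi i 0) = r i 0 * cos (phi i 0).
Proof. by rewrite mxE /= mul0r subr0. Qed.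

Lemma polar_Im n (r phi : 'cV[R]_n) i :
  complex.Im (polar r phi i 0) = r i 0 * sin (phi i 0).
Proof. by rewrite mxE /= mul0r addr0. Qed.

(** The right-hand side sees [r] and [phi] only through the complex number, whose polar coordinates
    are not unique. *)
Lemma mul_sin_sub n (r phi : 'cV[R]_n) i (a : R) :
  r i 0 * sin (a - phi i 0) =
  sin a * complex.Re (polar r phi i 0) - cos a * complex.Im (polar r phi i 0).
Proof. by rewrite polar_Re polar_Im sinB; ring. Qed.

Lemma Re_toC_mulmx n m (B : 'M[R]_(n, m)) (z : 'cV[R[i]]_m) i :
  complex.Re ((toC B *m z) i 0) = \sum_j B i j * complex.Re (z j 0).
Proof.
rewrite mxE (big_morph (@complex.Re R) (id1 := 0) (op1 := +%R)) => [|[? ?] [? ?]|] //.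
by apply: eq_bigr => j _; rewrite mxE; case: (z j 0) => ? ? /=; rewrite mul0r subr0.
Qed.

Lemma Im_toC_mulmx n m (B : 'M[R]_(n, m)) (z : 'cV[R[i]]_m) i :
  complex.Im ((toC B *m z) i 0) = \sum_j B i j * complex.Im (z j 0).
Proof.
rewrite mxE (big_morph (@complex.Im R) (id1 := 0) (op1 := +%R)) => [|[? ?] [? ?]|] //.
by apply: eq_bigr => j _; rewrite mxE; case: (z j 0) => ? ? /=; rewrite mul0r addr0.
Qed.

End PolarCoordinates.

Lemma has_velocity_odd_extension (R : realType) (n : nat) (x v : R -> 'cV[R]_n) :
  has_velocity x v ->
  forall t : R, 0 <= t ->
  forall i, is_derive t 1 (odd_extension (fun s => x s i 0)) (v t i 0).
Proof.
by move=> xv t t_ge0 i; apply: is_derive_odd_extension => //; exact: xv.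
Qed.

(** * Elimination of the bus voltages and uniqueness of solutions *)

Section PowerSystemUniqueness.
Variables (R : realType) (n m : nat) (S : power_system R n m).

Lemma block_mx_laplacian :
  block_mx (L11_mx S) (L12_mx S) (L12_mx S)^T (L22_mx S) = laplacian (grid S).
Proof.
rewrite /L11_mx /L12_mx /L22_mx -[in (ursubmx _)^T](laplacian_sym (grid S)).
by rewrite trmx_ursub trmxK submxK.
Qed.

(** The links to the internal generator voltages, seen as shunt conductances at the generator
    buses. *)
Definition grounding : 'rV[R]_(n + m) :=
  row_mx (\row_i (gen_reactance S i 0)^-1) 0.

Lemma grounded_grid_unit : laplacian (grid S) + diag_mx grounding \in unitmx.
Proof.
have ground_gt0 i : 0 < grounding 0 (lshift m i).
  by rewrite row_mxEl mxE invr_gt0 gen_reactance_gt0.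
apply: (@grounded_laplacian_unit _ _ _ _ (lshift m (Ordinal (gen_nonempty S)))) => // i.
rewrite -(splitK i); case: (fintype.split i) => j /=; first exact: ltW.
by rewrite row_mxEr mxE.
Qed.

(** The linear map from internal generator voltages to all bus voltages. It is real, so it acts
    separately on real and imaginary parts. *)
Definition voltage_mx : 'M[R]_(n + m, n) :=
  invmx (laplacian (grid S) + diag_mx grounding) *m col_mx (LD_mx S) 0.

(** Moving [LD_mx S *m VG] to the side of the Laplacian adds the grounding to it, and the resulting
    matrix is invertible. *)
Lemma network_equation_solved (e VG : 'cV[R[i]]_n) (VN : 'cV[R[i]]_m) :
  col_mx (toC (LD_mx S) *m (e - VG)) 0
    = toC (block_mx (L11_mx S) (L12_mx S) (L12_mx S)^T (L22_mx S)) *m col_mx VG VN ->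
  col_mx VG VN = toC voltage_mx *m e.
Proof.
rewrite block_mx_laplacian => eqV; rewrite /toC /voltage_mx map_mxM map_invmx.
rewrite map_col_mx map_mx0 -mulmxA mul_col_mx mul0mx.
apply: (canRL (mulKmx _)); first by rewrite map_unitmx grounded_grid_unit.
rewrite map_mxD mulmxDl -/(toC _) -eqV diag_mx_row map_block_mx !map_mx0.
rewrite raddf0 map_mx0 mul_block_col !mul0mx addr0 add_col_mx addr0.
by rewrite mulmxBr subrK addr0.
Qed.

(** [mul_sin_sub] turns [V_i sin(delta_i - theta_i)] into a linear expression in the bus voltage;
    substituting the solved network equation leaves sines of phase differences only. *)
Lemma swing_equation (delta ddelta dddelta V theta : 'cV[R]_n)
    (VG : 'cV[R[i]]_n) (VN : 'cV[R[i]]_m) :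
  [/\ VG = polar V theta,
      inertia_mx S *m dddelta + damping_mx S *m ddelta
      = input_power S
        - \col_i (gen_voltage S i 0 * V i 0 / gen_reactance S i 0
                  * sin (delta i 0 - theta i 0)) &
      col_mx (toC (LD_mx S) *m (polar (gen_voltage S) delta - VG)) 0
      = toC (block_mx (L11_mx S) (L12_mx S) (L12_mx S)^T (L22_mx S))
        *m col_mx VG VN] ->
  forall i, inertia S i 0 * dddelta i 0 =
    input_power S i 0 - damping S i 0 * ddelta i 0 -
    gen_voltage S i 0 / gen_reactance S i 0 *
    \sum_j voltage_mx (lshift m i) j * gen_voltage S j 0 * sin (delta i 0 - delta j 0).
Proof.
case=> VGE swing /network_equation_solved VE i.
have VGi : VG i 0 = (toC voltage_mx *m polar (gen_voltage S) delta) (lshift m i) 0.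
  by rewrite -VE col_mxEu.
have := congr1 (fun u : 'cV_n => u i 0) swing.
rewrite /inertia_mx /damping_mx !mul_diag_mx !mxE => swing_i.
have -> : \sum_j voltage_mx (lshift m i) j * gen_voltage S j 0 * sin (delta i 0 - delta j 0)
    = V i 0 * sin (delta i 0 - theta i 0).
  rewrite mul_sin_sub -VGE VGi Re_toC_mulmx Im_toC_mulmx !mulr_sumr -sumrB.
  by apply: eq_bigr => j _; rewrite polar_Re polar_Im sinB; ring.
by rewrite -[LHS](addrK (damping S i 0 * ddelta i 0)) swing_i; ring.
Qed.

Lemma solution_unique (delta1 ddelta1 delta2 ddelta2 : R -> 'cV[R]_n)
    (VG1 VG2 : R -> 'cV[R[i]]_n) (VN1 VN2 : R -> 'cV[R[i]]_m) :
  solution S delta1 ddelta1 VG1 VN1 -> solution S delta2 ddelta2 VG2 VN2 ->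
  delta1 0 = delta2 0 -> ddelta1 0 = ddelta2 0 ->
  forall t, 0 <= t -> [/\ delta1 t = delta2 t, VG1 t = VG2 t & VN1 t = VN2 t].
Proof.
move=> [a1 [V1 [th1 [dd1 da1 eq1]]]] [a2 [V2 [th2 [dd2 da2 eq2]]]] delta0 ddelta0.
(* Odd extensions supply the two-sided derivative at 0 that the Gronwall bound asks for; on
   nonnegative times they agree with the phases. *)
pose x i s := odd_extension (fun s => delta1 s i 0) s -
              odd_extension (fun s => delta2 s i 0) s.
pose v i s := odd_extension (fun s => ddelta1 s i 0) s -
              odd_extension (fun s => ddelta2 s i 0) s.
pose a i (s : R) := a1 s i 0 - a2 s i 0.
have xE s i : 0 <= s -> x i s = delta1 s i 0 - delta2 s i 0.
  by rewrite /x /odd_extension => ->.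
have vE s i : 0 <= s -> v i s = ddelta1 s i 0 - ddelta2 s i 0.
  by rewrite /v /odd_extension => ->.
have dx (t : R) : 0 <= t -> forall i, is_derive t 1 (x i) (ddelta1 t i 0 - ddelta2 t i 0).
  by move=> t_ge0 i; apply: is_deriveB; exact: has_velocity_odd_extension.
have dv (t : R) : 0 <= t -> forall i, is_derive t 1 (v i) (a i t).
  by move=> t_ge0 i; apply: is_deriveB; exact: has_velocity_odd_extension.
have dxv (t : R) : 0 <= t -> forall i, is_derive t 1 (x i) (v i t).
  by move=> t_ge0 i; rewrite vE //; exact: dx.
pose g i := gen_voltage S i 0 / gen_reactance S i 0.
pose b i j := voltage_mx (lshift m i) j * gen_voltage S j 0.
(* A Lipschitz constant for the [i]-th acceleration. The factor 2 comes from [|x_i - x_j| <= 2 * T];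
   the sum of all [Ci] then works for every [i]. *)
pose Ci i := (inertia S i 0)^-1 * (damping S i 0 + `|g i| * \sum_j 2 * `|b i j|).
have Ci_ge0 i : 0 <= Ci i.
  rewrite mulr_ge0 ?invr_ge0 ?(ltW (inertia_gt0 S i)) //.
  by rewrite addr_ge0 ?damping_ge0 // mulr_ge0 // sumr_ge0 // => j _; rewrite mulr_ge0.
have a_le (t : R) : 0 <= t -> forall i,
    `|a i t| <= (\sum_i Ci i) * \sum_j (`|x j t| + `|v j t|).
  move=> t_ge0 i; set T := \sum_j (`|x j t| + _).
  have le_T j : `|x j t| + `|v j t| <= T.
    by rewrite /T (bigD1 j) //= lerDl sumr_ge0 // => l _; rewrite addr_ge0.
  have T_ge0 : 0 <= T by rewrite sumr_ge0 // => l _; rewrite addr_ge0.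
  have x_le j : `|x j t| <= T by rewrite (le_trans _ (le_T j)) // lerDl.
  have v_le j : `|v j t| <= T by rewrite (le_trans _ (le_T j)) // lerDr.
  apply: (@le_trans _ _ (Ci i * T)); last first.
    by rewrite ler_wpM2r // (bigD1 i) //= lerDl sumr_ge0.
  rewrite /Ci -mulrA mulrC ler_pdivlMr ?inertia_gt0 //.
  rewrite -[X in _ * X](gtr0_norm (inertia_gt0 S i)) -normrM mulrC.
  (* The two swing equations are subtracted, which cancels the input power. *)
  have -> : inertia S i 0 * a i t = - (damping S i 0 * v i t) -
      g i * \sum_j b i j * (sin (delta1 t i 0 - delta1 t j 0) -
                            sin (delta2 t i 0 - delta2 t j 0)).
    rewrite /a mulrBr (swing_equation (eq1 t t_ge0)) (swing_equation (eq2 t t_ge0)).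
    under [in RHS]eq_bigr do rewrite mulrBr.
    by rewrite sumrB vE // /g /b; ring.
  rewrite (le_trans (ler_normB _ _)) // normrN (normrM (damping _ _ _)) (normrM (g i)) mulrDl lerD //.
    by rewrite ger0_norm ?damping_ge0 // ler_wpM2l ?damping_ge0.
  rewrite -[leRHS]mulrA ler_wpM2l // mulr_suml (le_trans (ler_norm_sum _ _ _)) //.
  apply: ler_sum => j _; rewrite normrM -mulrA mulrCA ler_wpM2l //.
  rewrite (le_trans (ler_dist_sin _ _)) //.
  have -> : delta1 t i 0 - delta1 t j 0 - (delta2 t i 0 - delta2 t j 0) =
      x i t - x j t by rewrite !xE //; ring.
  by rewrite (le_trans (ler_normB _ _)) // mulr_natl mulr2n lerD.
have x0 i : x i 0 = 0 by rewrite xE // delta0 subrr.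
have v0 i : v i 0 = 0 by rewrite vE // ddelta0 subrr.
have C_ge0 : 0 <= \sum_i Ci i by exact: sumr_ge0.
move=> t t_ge0.
have delta_eq : delta1 t = delta2 t.
  apply/colP => i.
  have [+ _] := second_order_gronwall_eq0 dxv dv a_le C_ge0 x0 v0 t_ge0 i.
  by rewrite xE // => /eqP; rewrite subr_eq0 => /eqP.
have [_ _ /network_equation_solved VE1] := eq1 t t_ge0.
have [_ _ /network_equation_solved VE2] := eq2 t t_ge0.
have /eq_col_mx [] : col_mx (VG1 t) (VN1 t) = col_mx (VG2 t) (VN2 t).
  by rewrite VE1 VE2 delta_eq.
by [].
Qed.

End PowerSystemUniqueness.

(** * Aggregation *)

Lemma posdef_diag_mx (R : realType) (n : nat) (d : 'rV[R]_n) :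
  (forall i, 0 < d 0 i) -> posdef (diag_mx d).
Proof.
move=> d_gt0; split=> [|x]; first exact: tr_diag_mx.
rewrite ltNge; apply: contraNN => q_le0; apply/eqP/colP => i; rewrite mxE; apply/eqP.
have qE : (x^T *m diag_mx d *m x) 0 0 = \sum_j d 0 j * x j 0 ^+ 2.
  by rewrite mul_mx_diag mxE; apply: eq_bigr => j _; rewrite !mxE; ring.
have q_ge0 j : 0 <= d 0 j * x j 0 ^+ 2 by rewrite mulr_ge0 ?sqr_ge0 ?ltW.
have : \sum_j d 0 j * x j 0 ^+ 2 == 0.
  by rewrite eq_le -qE q_le0 qE sumr_ge0.
rewrite psumr_eq0 // => /allP /(_ i (mem_index_enum _)) /=.
by rewrite mulf_eq0 sqrf_eq0 gt_eqF.
Qed.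

Lemma possemidef_diag_mx (R : realType) (n : nat) (d : 'rV[R]_n) :
  (forall i, 0 <= d 0 i) -> possemidef (diag_mx d).
Proof.
move=> d_ge0; split=> [|x]; first exact: tr_diag_mx.
rewrite mul_mx_diag mxE sumr_ge0 // => j _; rewrite !mxE.
by rewrite mulrAC -expr2 mulr_ge0 ?sqr_ge0.
Qed.

(** Covering yields [c], disjointness together with injectivity of [I] makes the index unique, and
    nonemptiness yields the representatives. *)
Lemma clustering_index (n k : nat) (I : 'I_k -> {set 'I_n}) :
  clustering I -> exists c : 'I_n -> 'I_k, exists rep : 'I_k -> 'I_n,
    (forall i l, (i \in I l) = (c i == l)) /\ cancel rep c.
Proof.
case=> I_inj /and3P[/eqP cover_I trivI nonempty].
have /fin_all_exists [c cP] : forall i, exists l, i \in I l.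
  move=> i; have : i \in finset.cover [set I l | l in 'I_k]%SET by rewrite cover_I inE.
  by case/finset.bigcupP => _ /imsetP[l _ ->] il; exists l.
have cE i l : (i \in I l) = (c i == l).
  apply/idP/eqP => [il|<- //]; apply: I_inj.
  have in_I l' : I l' \in [set I l | l in 'I_k]%SET by apply/imsetP; exists l'.
  by rewrite -(finset.def_pblock trivI (in_I _) (cP i)) (finset.def_pblock trivI (in_I l)).
have /fin_all_exists [rep repP] : forall l, exists i, i \in I l.
  move=> l; apply/finset.set0Pn; apply: contraNneq nonempty => <-.
  by apply/imsetP; exists l.
by exists c, rep; split=> // l; apply/eqP; rewrite -cE.
Qed.

Lemma aggregation_fiber_mx (R : realType) (n k : nat) (I : 'I_k -> {set 'I_n})
    (c : 'I_n -> 'I_k) :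
  (forall i l, (i \in I l) = (c i == l)) -> aggregation_mx R I = fiber_mx R c.
Proof. by move=> cE; apply/matrixP => i l; rewrite !mxE cE. Qed.

Lemma toC_mulmx (R : realType) (p q r : nat) (A : 'M[R]_(p, q)) (B : 'M[R]_(q, r)) :
  toC (A *m B) = toC A *m toC B.
Proof. exact: map_mxM. Qed.

Lemma toC_fiber_mx (R : realType) (n k : nat) (c : 'I_n -> 'I_k) :
  toC (fiber_mx R c) = fiber_mx R[i] c.
Proof. by apply/matrixP => i l; rewrite !mxE rmorph_nat. Qed.

(** The Gram matrix is diagonal and its entries are the fiber sizes, positive by surjectivity. *)
Lemma fiber_mx_gram_unit (R : realType) (n k : nat) (c : 'I_n -> 'I_k) :
  (forall l, exists i, c i = l) ->
  (fiber_mx R c)^T *m fiber_mx R c \in unitmx.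
Proof.
move=> c_surj; rewrite -[X in X *m _]mulmx1 -diag_const_mx fiber_diag_mx.
rewrite unitmxE det_diag unitfE; apply/prodf_neq0 => l _.
have [i ci] := c_surj l; rewrite mxE gt_eqF // (bigD1 i) ?ci //= mxE.
by rewrite ltr_pwDl // sumr_ge0 // => j _; rewrite mxE.
Qed.

(** On cluster-constant vectors, sampling at representatives inverts the aggregation matrix and so
    replaces averaging over clusters. *)
Lemma fiber_mx_rowsub (T : pzSemiRingType) (n k : nat) (c : 'I_n -> 'I_k)
    (rep : 'I_k -> 'I_n) (x : 'cV[T]_n) :
  cancel rep c -> (forall i j, c i = c j -> x i 0 = x j 0) ->
  x = fiber_mx T c *m rowsub rep x.
Proof.
move=> repK x_cst; apply/colP => i; rewrite fiber_mxE mxE.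
by apply: x_cst; rewrite repK.
Qed.

Lemma has_velocity_rowsub (R : realType) (n k : nat) (f : 'I_k -> 'I_n)
    (x v : R -> 'cV[R]_n) :
  has_velocity x v ->
  has_velocity (fun t => rowsub f (x t)) (fun t => rowsub f (v t)).
Proof.
move=> xv t t_ge0 l.
have -> : (fun s => (rowsub f (x s) l 0 - rowsub f (x t) l 0) / (s - t)) =
    (fun s => (x s (f l) 0 - x t (f l) 0) / (s - t)).
  by apply/funext => s; rewrite !mxE.
by rewrite mxE; exact: xv.
Qed.

(** Entries that agree on nonnegative times have equal odd extensions on the whole line, hence equal
    derivatives. *)
Lemma has_velocity_eq_entries (R : realType) (n : nat) (x v : R -> 'cV[R]_n)
    (i j : 'I_n) :
  has_velocity x v -> (forall t : R, 0 <= t -> x t i 0 = x t j 0) ->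
  forall t : R, 0 <= t -> v t i 0 = v t j 0.
Proof.
move=> xv x_ij t t_ge0.
have [_ <-] := has_velocity_odd_extension xv t_ge0 i.
have [_ <-] := has_velocity_odd_extension xv t_ge0 j.
congr ('D_1 _ t); apply/funext => s; rewrite /odd_extension; case: ifPn => [/x_ij //|].
by rewrite -ltNge => s_lt0; rewrite !x_ij // oppr_ge0 ltW.
Qed.

(** The two notions differ only in whether the inverse reactances stand inside the column or in
    front of it as a matrix. The equivalence makes uniqueness available for the reduced model. *)
Lemma reduced_solutionE (R : realType) (n m : nat) (S : power_system R n m)
    (delta ddelta : R -> 'cV[R]_n) VG (VN : R -> 'cV[R[i]]_m) :
  reduced_solution (inertia_mx S) (damping_mx S) (LD_mx S) (L11_mx S) (L12_mx S)
    (L22_mx S) (input_power S) (gen_voltage S) delta ddelta VG VN <->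
  solution S delta ddelta VG VN.
Proof.
have LDE (V theta d : 'cV[R]_n) :
    LD_mx S *m \col_i (gen_voltage S i 0 * V i 0 * sin (d i 0 - theta i 0)) =
    \col_i (gen_voltage S i 0 * V i 0 / gen_reactance S i 0 * sin (d i 0 - theta i 0)).
  by apply/colP => i; rewrite /LD_mx mul_diag_mx !mxE; ring.
by split=> -[a [V [theta [dd da eqs]]]]; exists a, V, theta; split=> // t /eqs;
  rewrite LDE.
Qed.

(** * The reduced power system and the passage of synchronous solutions to it *)

Section Reduction.
Variables (R : realType) (n m k : nat) (S : power_system R n m).
Variables (c : 'I_n -> 'I_k) (rep : 'I_k -> 'I_n) (repK : cancel rep c).
Variables (Eh : 'cV[R]_k).

Local Notation P := (fiber_mx R c).

Definition bus_map (i : 'I_(n + m)) : 'I_(k + m) :=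
  match fintype.split i with inl i' => lshift m (c i') | inr j => rshift k j end.

Lemma bus_map_surj a : exists i, bus_map i = a.
Proof.
rewrite -(splitK a); case: (fintype.split a) => [l|j] /=.
  exists (lshift m (rep l)); rewrite /bus_map.
  by case: split_ordP => [i /lshift_inj <-|j /eqP]; rewrite ?repK // eq_lrshift.
exists (rshift n j); rewrite /bus_map.
by case: split_ordP => [i /eqP|j' /rshift_inj <- //]; rewrite eq_rlshift.
Qed.

Lemma fiber_mx_bus_map (T : pzSemiRingType) :
  fiber_mx T bus_map = block_mx (fiber_mx T c) 0 0 1%:M.
Proof.
apply/matrixP => i a; rewrite mxE /bus_map; case: split_ordP => i' ->.
  rewrite -(splitK a); case: (fintype.split a) => l /=.
    by rewrite block_mxEul mxE eq_lshift.
  by rewrite block_mxEur mxE eq_lrshift.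
rewrite -(splitK a); case: (fintype.split a) => l /=.
  by rewrite block_mxEdl mxE eq_rlshift.
by rewrite block_mxEdr mxE eq_rshift.
Qed.

Let sum_gt0 (f : 'I_n -> R) l : (forall i, 0 < f i) -> 0 < \sum_(i | c i == l) f i.
Proof.
move=> f_gt0; rewrite (bigD1 (rep l)) ?repK //= ltr_pwDl // sumr_ge0 // => i _.
exact: ltW.
Qed.

Let inertiah : 'cV[R]_k := \col_l \sum_(i | c i == l) inertia S i 0.
Let dampingh : 'cV[R]_k := \col_l \sum_(i | c i == l) damping S i 0.
(** The generator reactances of a cluster are connected in parallel. *)
Let reactanceh : 'cV[R]_k := \col_l (\sum_(i | c i == l) (gen_reactance S i 0)^-1)^-1.

Let k_gt0 : (0 < k)%N.
Proof. exact: leq_ltn_trans (ltn_ord (c (Ordinal (gen_nonempty S)))). Qed.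

Let inertiah_gt0 l : 0 < inertiah l 0.
Proof. by rewrite mxE; apply: sum_gt0 => i; exact: inertia_gt0. Qed.

Let dampingh_ge0 l : 0 <= dampingh l 0.
Proof. by rewrite mxE sumr_ge0 // => i _; exact: damping_ge0. Qed.

Let reactanceh_gt0 l : 0 < reactanceh l 0.
Proof.
by rewrite mxE invr_gt0; apply: sum_gt0 => i; rewrite invr_gt0 gen_reactance_gt0.
Qed.

Definition reduced_system : power_system R k m :=
  PowerSystem (P^T *m input_power S) Eh
    (quotient_network (grid S) bus_map_surj)
    k_gt0 inertiah_gt0 dampingh_ge0 reactanceh_gt0.

Lemma reduced_inertia_mx : inertia_mx reduced_system = P^T *m inertia_mx S *m P.
Proof.
rewrite /inertia_mx fiber_diag_mx; congr diag_mx; apply/rowP => l.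
by rewrite !mxE; apply: eq_bigr => i _; rewrite mxE.
Qed.

Lemma reduced_damping_mx : damping_mx reduced_system = P^T *m damping_mx S *m P.
Proof.
rewrite /damping_mx fiber_diag_mx; congr diag_mx; apply/rowP => l.
by rewrite !mxE; apply: eq_bigr => i _; rewrite mxE.
Qed.

Lemma reduced_LD_mx : LD_mx reduced_system = P^T *m LD_mx S *m P.
Proof.
rewrite /LD_mx fiber_diag_mx; congr diag_mx; apply/rowP => l.
by rewrite !mxE invrK; apply: eq_bigr => i _; rewrite mxE.
Qed.

(** The quotient Laplacian is a congruence by the block diagonal matrix with blocks [P] and the
    identity, since [bus_map] merges generator buses only. *)
Lemma reduced_laplacian :
  laplacian (grid reduced_system) =
  block_mx (P^T *m L11_mx S *m P) (P^T *m L12_mx S) (P^T *m L12_mx S)^T (L22_mx S).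
Proof.
rewrite laplacian_quotient -block_mx_laplacian fiber_mx_bus_map tr_block_mx.
rewrite !mulmx_block trmx1 !trmx0 trmx_mul trmxK.
by rewrite !(mul0mx, mulmx0, mul1mx, mulmx1, addr0, add0r).
Qed.

Lemma reduced_systemP (deltah ddeltah : R -> 'cV[R]_k) Vh (VNh : R -> 'cV[R[i]]_m) :
  reduced_solution (P^T *m inertia_mx S *m P) (P^T *m damping_mx S *m P)
    (P^T *m LD_mx S *m P) (P^T *m L11_mx S *m P) (P^T *m L12_mx S) (L22_mx S)
    (P^T *m input_power S) Eh deltah ddeltah Vh VNh <->
  solution reduced_system deltah ddeltah Vh VNh.
Proof.
rewrite -reduced_solutionE -reduced_inertia_mx -reduced_damping_mx -reduced_LD_mx.
have [<- <- _ <-] := eq_block_mx (etrans (block_mx_laplacian _) reduced_laplacian).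
by [].
Qed.

Hypothesis hE : gen_voltage S = P *m Eh.

(** Every vector in the equations that is constant on clusters is [P] times its samples; multiplying
    the generator rows by [P^T] then gives the reduced equations. *)
Lemma synchronous_solution_reduced (delta ddelta : R -> 'cV[R]_n) VG
    (VN : R -> 'cV[R[i]]_m) :
  solution S delta ddelta VG VN ->
  (forall t : R, 0 <= t -> forall i j, c i = c j ->
     delta t i 0 = delta t j 0 /\ VG t i 0 = VG t j 0) ->
  reduced_solution (P^T *m inertia_mx S *m P) (P^T *m damping_mx S *m P)
    (P^T *m LD_mx S *m P) (P^T *m L11_mx S *m P) (P^T *m L12_mx S) (L22_mx S)
    (P^T *m input_power S) Eh
    (fun t => rowsub rep (delta t)) (fun t => rowsub rep (ddelta t))
    (fun t => rowsub rep (VG t)) VN.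
Proof.
move=> [dddelta [V [theta [dd ddd eqs]]]] sync.
have delta_cst (t : R) : 0 <= t -> forall i j, c i = c j -> delta t i 0 = delta t j 0.
  by move=> t_ge0 i j /(sync t t_ge0)[].
have ddelta_cst (t : R) : 0 <= t -> forall i j, c i = c j -> ddelta t i 0 = ddelta t j 0.
  move=> t_ge0 i j ij; apply: (has_velocity_eq_entries dd) t_ge0 => s s_ge0.
  exact: delta_cst.
have dddelta_cst (t : R) : 0 <= t -> forall i j, c i = c j -> dddelta t i 0 = dddelta t j 0.
  move=> t_ge0 i j ij; apply: (has_velocity_eq_entries ddd) t_ge0 => s s_ge0.
  exact: ddelta_cst.
exists (fun t => rowsub rep (dddelta t)), (fun t => rowsub rep (V t)),
  (fun t => rowsub rep (theta t)).
split=> [||t t_ge0]; [exact: has_velocity_rowsub.. |].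
have [VGE swing network] := eqs t t_ge0.
have VG_cst i j : c i = c j -> VG t i 0 = VG t j 0 by move=> /(sync t t_ge0)[].
split.
- by apply/colP => l; rewrite mxE VGE !mxE.
(* Contracting [P] with the samples restores the original vectors, so the original swing equation
   can be used under [P^T]. *)
- rewrite -!mulmxA -!(fiber_mx_rowsub repK) //; [|exact: ddelta_cst|exact: dddelta_cst].
  rewrite -mulmxDr swing mulmxBr; congr (_ - P^T *m _).
  apply/colP => i; rewrite /LD_mx mul_diag_mx mxE hE fiber_mxE [RHS]mxE fiber_mxE !mxE.
  (* Amplitude and phase may differ between [i] and its representative; only this product is known
     to agree. *)
  have same : V t i 0 * sin (delta t i 0 - theta t i 0) =
      V t (rep (c i)) 0 * sin (delta t (rep (c i)) 0 - theta t (rep (c i)) 0).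
    have ci : c i = c (rep (c i)) by rewrite repK.
    by rewrite !mul_sin_sub -VGE (delta_cst t t_ge0 _ _ ci) (VG_cst _ _ ci).
  by rewrite -(mulrA (Eh _ _)) -same; ring.
have VGP := fiber_mx_rowsub repK VG_cst.
have EP : polar (gen_voltage S) (delta t) = toC P *m polar Eh (rowsub rep (delta t)).
  apply/colP => i; rewrite toC_fiber_mx fiber_mxE hE mxE fiber_mxE !mxE.
  by rewrite (delta_cst t t_ge0 i (rep (c i))) ?repK.
move: network; rewrite EP {1 2}VGP -toC_fiber_mx /toC !map_block_mx !mul_block_col.
rewrite -!/(toC _) -mulmxBr => /eq_col_mx[eq1 eq2].
(* The lower block row is the original one, as the transpose of [P^T *m L12_mx S] applied to the
   samples is [(L12_mx S)^T] applied to [VG t]; the upper one is the original multiplied by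
   [P^T]. *)
rewrite trmx_mul trmxK !toC_mulmx -!mulmxA -mulmxDr; congr col_mx => //.
by rewrite eq1.
Qed.

End Reduction.

(** * Exactness of the reduction and structure of the reduced matrices *)

Unset Implicit Arguments.

Theorem mainTheorem4 (R : realType) (n m k : nat) (S : power_system R n m)
    (I : 'I_k -> {set 'I_n}) (hI : clustering I)
    (hsync : weakly_synchronized S I)
    (Eh : 'cV[R]_k) (hE : gen_voltage S = aggregation_mx R I *m Eh) :
  let P := aggregation_mx R I in
  let Mh := P^T *m inertia_mx S *m P in
  let Dh := P^T *m damping_mx S *m P in
  let fh := P^T *m input_power S in
  let LDh := P^T *m LD_mx S *m P in
  let L11h := P^T *m L11_mx S *m P in
  let L12h := P^T *m L12_mx S in
  let L22 := L22_mx S in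
  let Lh := block_mx L11h L12h L12h^T L22 in
  let reduced := reduced_solution Mh Dh LDh L11h L12h L22 fh Eh in
  (forall delta ddelta VG VN,
     solution S delta ddelta VG VN ->
     in_Xcl I (delta 0) -> in_Xcl I (ddelta 0) ->
     let initial (deltah ddeltah : R -> 'cV[R]_k) :=
       deltah 0 = invmx (P^T *m P) *m P^T *m delta 0 /\
       ddeltah 0 = invmx (P^T *m P) *m P^T *m ddelta 0 in
     (exists deltah ddeltah Vh VNh,
        reduced deltah ddeltah Vh VNh /\ initial deltah ddeltah) /\
     (forall deltah ddeltah Vh VNh,
        reduced deltah ddeltah Vh VNh -> initial deltah ddeltah ->
        forall t : R, 0 <= t ->
        [/\ delta t = P *m deltah t,
            VG t = toC P *m Vh t &
            VN t = VNh t])) /\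
  (exists Sh : power_system R k m,
     [/\ inertia_mx Sh = Mh, damping_mx Sh = Dh & LD_mx Sh = LDh] /\
     [/\ input_power Sh = fh, gen_voltage Sh = Eh & laplacian (grid Sh) = Lh] /\
     (forall deltah ddeltah Vh VNh,
        reduced deltah ddeltah Vh VNh <-> solution Sh deltah ddeltah Vh VNh)) /\
  [/\ is_diag_mx Mh /\ posdef Mh,
      is_diag_mx Dh /\ possemidef Dh,
      (forall l, exists2 i, i \in I l & 0 < damping S i 0) -> posdef Dh,
      is_diag_mx LDh /\ posdef LDh &
      is_laplacian Lh].
Proof.
have [c [rep [cE repK]]] := clustering_index hI.
move: hE; rewrite (aggregation_fiber_mx R cE) => {}hE P Mh Dh fh LDh L11h L12h L22 Lh reduced.
have Xcl (T : Type) (x : 'cV[T]_n) : in_Xcl I x -> forall i j, c i = c j -> x i ord0 = x j ord0.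
  by move=> x_cl i j ij; apply: (x_cl (c i)); rewrite cE ?ij.
have c_surj l : exists i, c i = l by exists (rep l).
have initE (x : 'cV[R]_n) : in_Xcl I x -> rowsub rep x = invmx (P^T *m P) *m P^T *m x.
  move=> /Xcl x_cl; rewrite {2}(fiber_mx_rowsub repK x_cl) -mulmxA (mulmxA P^T).
  by rewrite mulKmx ?fiber_mx_gram_unit.
pose Sh := reduced_system S repK Eh.
have inertia_eq : inertia_mx Sh = Mh := reduced_inertia_mx _ _ _.
have damping_eq : damping_mx Sh = Dh := reduced_damping_mx _ _ _.
have LD_eq : LD_mx Sh = LDh := reduced_LD_mx _ _ _.
have laplacian_eq : laplacian (grid Sh) = Lh := reduced_laplacian _ _ _.
split.
  move=> delta ddelta VG VN sol delta0 ddelta0 initial.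
  have sync (t : R) : 0 <= t -> forall i j, c i = c j ->
      delta t i 0 = delta t j 0 /\ VG t i 0 = VG t j 0.
    move=> t_ge0 i j ij; have [delta_cl VG_cl] := hsync _ _ _ _ sol delta0 ddelta0 t t_ge0.
    by split; [exact: (Xcl _ _ delta_cl) | exact: (Xcl _ _ VG_cl)].
  have red := synchronous_solution_reduced repK hE sol sync.
  split.
    (* Existence calls for no existence theorem for differential equations: the sampled original
       solution is the witness. *)
    do 4!eexists; split; first exact: red.
    by split; exact: initE.
  move=> deltah ddeltah Vh VNh redh [deltah0 ddeltah0] t t_ge0.
  move/(reduced_systemP S repK Eh): red => solh.
  move/(reduced_systemP S repK Eh): redh => solh'.
  (* Any reduced solution with these initial data coincides with the sampled one, whose image under
     [P] is the original solution. *)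
  have [] := solution_unique solh solh' _ _ t_ge0.
  - by rewrite deltah0; exact: initE.
  - by rewrite ddeltah0; exact: initE.
  move=> <- <- <-; split=> //.
    by apply: fiber_mx_rowsub => // i j /(sync t t_ge0)[].
  by rewrite toC_fiber_mx; apply: fiber_mx_rowsub => // i j /(sync t t_ge0)[].
split.
  exists Sh; split; first by [].
  by split=> // deltah ddeltah Vh VNh; exact: reduced_systemP.
split.
- rewrite -inertia_eq; split; first exact: diag_mx_is_diag.
  by apply: posdef_diag_mx => l; rewrite mxE inertia_gt0.
- rewrite -damping_eq; split; first exact: diag_mx_is_diag.
  by apply: possemidef_diag_mx => l; rewrite mxE damping_ge0.
(* Dampings are only nonnegative, so a cluster sum is positive once one generator in the cluster is
   damped. *)
- move=> damped; rewrite /Dh /damping_mx fiber_diag_mx.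
  apply: posdef_diag_mx => l; have [i il d_gt0] := damped l.
  rewrite mxE (bigD1 i) /=; last by rewrite -cE.
  rewrite mxE ltr_pwDl // sumr_ge0 // => j _; rewrite mxE; exact: damping_ge0.
- rewrite -LD_eq; split; first exact: diag_mx_is_diag.
  by apply: posdef_diag_mx => l; rewrite mxE invr_gt0 gen_reactance_gt0.
- by exists (grid Sh).
Qed.
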